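(* For every integer $n\ge 0$ and every real $x$, $$\sum_{k=0}^n (-1)^k s_{0,2k}(x)=\frac{\pi}{4}\mathbf{H}_0(x)+\frac{1}{2}\int_0^1\sin(xt)\frac{U_{2n}(t)}{\sqrt{1-t^2}}\,dt.$$
   Context: The Lommel function is $$s_{\mu,\nu}(z)= \frac{z^{\mu+1}}{(\mu+1)^2-\nu^2}\;{}_1F_2\left(1;\frac{\mu-\nu+3}{2},\frac{\mu+\nu+3}{2};-\frac{z^2}{4}\right),$$ where ${}_1F_2(\alpha;\beta,\gamma;w)=\sum_{k\ge 0}\frac{(\alpha)_k}{(\beta)_k(\gamma)_k}\frac{w^k}{k!}$ and $(\alpha)_k$ is the Pochhammer symbol. $U_m$ is the Chebyshev polynomial of the second kind, $U_m(\cos\phi)=\sin((m+1)\phi)/\sin\phi$. $\mathbf{H}_0$ is the Struve function of order $0$, $\mathbf{H}_0(z)=\frac{2}{\pi}\int_0^{\pi/2}\sin(z\cos\phi)\,d\phi$. *)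

(* Defs.v *)
From Stdlib Require Import Reals ZArith.
From Coquelicot Require Import Coquelicot.

Open Scope R_scope.

Fixpoint pochhammer (a : R) (k : nat) : R :=
  match k with
  | O => 1
  | S j => pochhammer a j * (a + INR j)
  end.

(* Meaningful when neither [b] nor [c] is a nonpositive integer; the series
   then converges absolutely for every [w]. *)
Definition hyp1F2 (a b c w : R) : R :=
  Series (fun k : nat =>
    pochhammer a k / (pochhammer b k * pochhammer c k)
    * (w ^ k / INR (fact k))).

(* [mu] is an integer, so that the power [z ^ (mu + 1)] is single-valued for
   negative [z] too.  For [mu = 0] and [nu = 2 k], the denominator is
   [1 - 4 k ^ 2] and the lower parameters are [3 / 2 - k] and [3 / 2 + k], so
   nothing is divided by zero. *)
Definition lommel_s (mu : Z) (nu z : R) : R :=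
  powerRZ z (mu + 1) / ((IZR mu + 1) ^ 2 - nu ^ 2)
  * hyp1F2 1 ((IZR mu - nu + 3) / 2) ((IZR mu + nu + 3) / 2) (- (z ^ 2 / 4)).

Definition struveH0 (z : R) : R :=
  2 / PI * RInt (fun phi : R => sin (z * cos phi)) 0 (PI / 2).

(* Defined by recurrence so as to be the polynomial at every [t], including
   [t = 1] and [t = -1]; [chebyshevU_cos] is the trigonometric identity that
   determines it. *)
Fixpoint chebyshevU (m : nat) (t : R) : R :=
  match m with
  | O => 1
  | S p =>
      match p with
      | O => 2 * t
      | S q => 2 * t * chebyshevU p t - chebyshevU q t
      end
  end.

Lemma chebyshevU_cos (m : nat) (phi : R) :
  sin phi <> 0 ->
  chebyshevU m (cos phi) = sin ((INR m + 1) * phi) / sin phi.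
Proof.
intros Hs.
enough (H : chebyshevU m (cos phi) = sin ((INR m + 1) * phi) / sin phi /\
            chebyshevU (S m) (cos phi) = sin ((INR (S m) + 1) * phi) / sin phi)
  by apply H.
induction m as [|m [IH0 IH1]].
- split; cbn [chebyshevU].
  + replace ((INR 0 + 1) * phi) with phi by (simpl; ring). field; exact Hs.
  + replace ((INR 1 + 1) * phi) with (2 * phi) by (simpl; ring).
    rewrite sin_2a. field; exact Hs.
- split; [exact IH1|].
  change (chebyshevU (S (S m)) (cos phi))
    with (2 * cos phi * chebyshevU (S m) (cos phi) - chebyshevU m (cos phi)).
  rewrite IH0, IH1, !S_INR.
  replace ((INR m + 1 + 1 + 1) * phi) with ((INR m + 1 + 1) * phi + phi) by ring.
  replace ((INR m + 1) * phi) with ((INR m + 1 + 1) * phi - phi) by ring.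
  rewrite sin_plus, sin_minus. field; exact Hs.
Qed.

(* Main.v *)
Require Import Defs.
From Stdlib Require Import Reals ZArith Lra Lia.
From Coquelicot Require Import Coquelicot.

(** For [nu] not an odd integer, the Lommel function of first index 0 is a
    finite Fourier-type integral:
    cos (nu pi / 2) s_{0,nu}(x)
      = int_0^{pi/2} sin (x cos phi) cos (nu phi) dphi
    ([lommel_s_0_integral]). At [nu = 2 k] the factor in front is [(-1) ^ k],
    so the alternating sum of the theorem is the integral of [sin (x cos phi)]
    against the Dirichlet-type kernel
    sum_{k <= n} cos (2 k phi) = 1/2 + 1/2 U_{2n}(cos phi)
    ([sum_cos_even]). The constant half of the kernel gives the Struve term;
    the other half becomes the stated improper integral under [t = cos phi]
    ([is_RInt_gen_cos_substitution]).

    The integral formula for s_{0,nu} is obtained by integrating the power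
    series of sin (x cos phi) term by term ([sin_cos_moment_series]). The
    moments of odd powers of cos phi against cos (nu phi) obey a two-step
    recurrence, coming from an explicit antiderivative ([cos_moment_1],
    [cos_moment_step]); solving it yields exactly the Pochhammer symbols of
    the hypergeometric series ([cos_moment_odd]). *)

Open Scope R_scope.

(** * Elementary facts *)

Lemma cos_INR_PI (k : nat) : cos (INR k * PI) = (-1) ^ k.
Proof.
induction k as [|k IH].
- simpl. rewrite Rmult_0_l. apply cos_0.
- rewrite S_INR.
  replace ((INR k + 1) * PI) with (INR k * PI + PI) by ring.
  rewrite neg_cos, IH. simpl. ring.
Qed.

Lemma pochhammer_1 (k : nat) : pochhammer 1 k = INR (fact k).
Proof.
induction k as [|k IH].
- reflexivity.
- cbn [pochhammer]. rewrite IH, fact_simpl, mult_INR, S_INR. ring.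
Qed.

Lemma ex_RInt_continuous_all (f : R -> R) (a b : R) :
  (forall t, continuous f t) -> ex_RInt f a b.
Proof.
intros Hf. apply (ex_RInt_continuous (V := R_CompleteNormedModule)).
intros t _. apply Hf.
Qed.

Lemma chebyshevU_continuous (m : nat) (t : R) : continuous (chebyshevU m) t.
Proof.
enough (H : continuous (chebyshevU m) t /\ continuous (chebyshevU (S m)) t)
  by apply H.
induction m as [|m [IH0 IH1]].
- split.
  + apply continuous_const.
  + apply (continuous_mult (fun _ : R => 2) (fun u : R => u)).
    * apply continuous_const.
    * apply continuous_id.
- split; [exact IH1|].
  apply (continuous_minus (fun u => 2 * u * chebyshevU (S m) u) (chebyshevU m));
    [|exact IH0].
  apply (continuous_mult (fun u : R => 2 * u) (chebyshevU (S m))); [|exact IH1].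
  apply (continuous_mult (fun _ : R => 2) (fun u : R => u)).
  + apply continuous_const.
  + apply continuous_id.
Qed.

(** * Moments of powers of the cosine *)

Definition cos_moment (nu : R) (m : nat) : R :=
  RInt (fun phi : R => cos phi ^ m * cos (nu * phi)) 0 (PI / 2).

Lemma cos_moment_correct (nu : R) (m : nat) :
  is_RInt (fun phi : R => cos phi ^ m * cos (nu * phi)) 0 (PI / 2)
    (cos_moment nu m).
Proof.
apply (RInt_correct (V := R_CompleteNormedModule)), ex_RInt_continuous_all.
intros t. apply (ex_derive_continuous (V := R_NormedModule)).
auto_derive; trivial.
Qed.

(** The function sin phi cos (nu phi) - nu cos phi sin (nu phi) is an
    antiderivative of (1 - nu^2) cos phi cos (nu phi). *)
Lemma cos_moment_1 (nu : R) :
  (1 - nu ^ 2) * cos_moment nu 1 = cos (nu * (PI / 2)).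
Proof.
assert (H : is_RInt (fun phi => (1 - nu ^ 2) * (cos phi ^ 1 * cos (nu * phi)))
  0 (PI / 2) ((1 - nu ^ 2) * cos_moment nu 1)).
{ apply (is_RInt_scal (V := R_NormedModule)), cos_moment_correct. }
pose (F := fun phi => sin phi * cos (nu * phi) - nu * cos phi * sin (nu * phi)).
assert (H' : is_RInt (fun phi => (1 - nu ^ 2) * (cos phi ^ 1 * cos (nu * phi)))
  0 (PI / 2) (F (PI / 2) - F 0)).
{ apply (is_RInt_derive (V := R_CompleteNormedModule) F).
  - intros t _. unfold F. auto_derive; trivial. simpl. ring.
  - intros t _. apply (ex_derive_continuous (V := R_NormedModule)).
    auto_derive; trivial. }
rewrite <- (is_RInt_unique _ _ _ _ H), (is_RInt_unique _ _ _ _ H').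
unfold F. rewrite cos_PI2, sin_PI2, sin_0, Rmult_0_r, sin_0. ring.
Qed.

(** Two integrations by parts of the second derivative of cos^(m+2) against
    cos (nu phi), packed into the single antiderivative
    nu cos^(m+2) sin (nu phi) - (m+2) cos^(m+1) sin cos (nu phi),
    which vanishes at both ends of the interval. *)
Lemma cos_moment_step (nu : R) (m : nat) :
  (INR (m + 2) ^ 2 - nu ^ 2) * cos_moment nu (m + 2) =
  INR (m + 2) * INR (m + 1) * cos_moment nu m.
Proof.
pose (f := fun phi =>
  INR (m + 2) * INR (m + 1) * (cos phi ^ m * cos (nu * phi))
  - (INR (m + 2) ^ 2 - nu ^ 2) * (cos phi ^ (m + 2) * cos (nu * phi))).
pose (F := fun phi =>
  nu * cos phi ^ (m + 2) * sin (nu * phi)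
  - INR (m + 2) * cos phi ^ (m + 1) * sin phi * cos (nu * phi)).
assert (H : is_RInt f 0 (PI / 2)
  (INR (m + 2) * INR (m + 1) * cos_moment nu m
   - (INR (m + 2) ^ 2 - nu ^ 2) * cos_moment nu (m + 2))).
{ apply (is_RInt_minus (V := R_NormedModule));
    apply (is_RInt_scal (V := R_NormedModule)), cos_moment_correct. }
assert (H' : is_RInt f 0 (PI / 2) (F (PI / 2) - F 0)).
{ apply (is_RInt_derive (V := R_CompleteNormedModule) F).
  - intros t _. unfold F, f. auto_derive; trivial.
    replace (pred (m + 2)) with (m + 1)%nat by lia.
    replace (pred (m + 1)) with m by lia.
    rewrite !pow_add, !plus_INR. simpl INR.
    assert (Hs : sin t * sin t = 1 - cos t * cos t)
      by (generalize (sin2_cos2 t); unfold Rsqr; lra).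
    simpl.
    transitivity
      (nu * nu * (cos t ^ m * (cos t * cos t)) * cos (nu * t)
       + (INR m + 2) * (INR m + 1) * cos t ^ m * cos (nu * t) * (sin t * sin t)
       - (INR m + 2) * (cos t ^ m * (cos t * cos t)) * cos (nu * t));
      [ring|].
    rewrite Hs. ring.
  - intros t _. apply (ex_derive_continuous (V := R_NormedModule)).
    unfold f. auto_derive; trivial. }
assert (E : F (PI / 2) - F 0 = 0).
{ unfold F. rewrite cos_PI2, sin_0, Rmult_0_r, sin_0, !pow_i by lia. ring. }
rewrite <- (is_RInt_unique _ _ _ _ H'), (is_RInt_unique _ _ _ _ H) in E. lra.
Qed.

(** Since ((2j+3)^2 - nu^2) / 4 = ((3-nu)/2 + j) ((3+nu)/2 + j), each use of
    the recurrence contributes one factor to each Pochhammer symbol and a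
    quarter to the power of 1/4. That the two symbols do not vanish is carried
    along the induction because the division by them needs it. *)
Lemma cos_moment_odd (nu : R) (j : nat) :
  (forall i : nat, INR (2 * i + 1) ^ 2 <> nu ^ 2) ->
  cos_moment nu (2 * j + 1) =
  cos (nu * (PI / 2)) / (1 - nu ^ 2) *
  (INR (fact (2 * j + 1)) * (/ 4) ^ j /
   (pochhammer ((3 - nu) / 2) j * pochhammer ((3 + nu) / 2) j)) /\
  pochhammer ((3 - nu) / 2) j <> 0 /\ pochhammer ((3 + nu) / 2) j <> 0.
Proof.
intros Hnu.
assert (H1 : 1 - nu ^ 2 <> 0).
{ generalize (Hnu 0%nat). simpl. lra. }
induction j as [|j (IH & Hb & Hc)].
- split; [|split; simpl; lra].
  change (2 * 0 + 1)%nat with 1%nat.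
  rewrite <- (cos_moment_1 nu). simpl. field.
  intros E. apply H1. lra.
- assert (Hj : INR (2 * S j + 1) = 2 * INR j + 3).
  { rewrite plus_INR, mult_INR, (S_INR j). simpl. ring. }
  assert (HD : (2 * INR j + 3) ^ 2 - nu ^ 2 <> 0).
  { generalize (Hnu (S j)). rewrite Hj. lra. }
  assert (Hb' : (3 - nu) / 2 + INR j <> 0).
  { intros E. apply HD. replace nu with (2 * INR j + 3) by lra. ring. }
  assert (Hc' : (3 + nu) / 2 + INR j <> 0).
  { intros E. apply HD. replace nu with (- (2 * INR j + 3)) by lra. ring. }
  cbn [pochhammer].
  split; [|split; apply Rmult_integral_contrapositive_currified; assumption].
  apply (Rmult_eq_reg_l ((2 * INR j + 3) ^ 2 - nu ^ 2)); [|exact HD].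
  generalize (cos_moment_step nu (2 * j + 1)).
  replace (2 * j + 1 + 2)%nat with (2 * S j + 1)%nat by lia.
  rewrite Hj. intros ->. rewrite IH.
  replace (fact (2 * S j + 1))
    with ((2 * j + 3) * ((2 * j + 2) * fact (2 * j + 1)))%nat.
  2:{ replace (2 * S j + 1)%nat with (S (S (2 * j + 1))) by lia.
      rewrite !fact_simpl. f_equal; [lia|f_equal; lia]. }
  rewrite !mult_INR.
  replace (INR (2 * j + 3)) with (2 * INR j + 3)
    by (rewrite plus_INR, mult_INR; simpl; ring).
  replace (INR (2 * j + 2)) with (2 * INR j + 2)
    by (rewrite plus_INR, mult_INR; simpl; ring).
  replace (INR (2 * j + 1 + 1)) with (2 * INR j + 2)
    by (rewrite !plus_INR, mult_INR; simpl; ring).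
  cbn [pow].
  replace ((2 * INR j + 3) * ((2 * INR j + 3) * 1) - nu * (nu * 1))
    with (4 * (((3 - nu) / 2 + INR j) * ((3 + nu) / 2 + INR j))) by field.
  cbn [pow] in H1. field.
  repeat split; trivial; lra.
Qed.

(** * Integrating the sine series term by term *)

Lemma Series_remainder_le (u v : nat -> R) (N : nat) :
  (forall k, Rabs (u k) <= v k) -> ex_series v ->
  Rabs (Series u - sum_f_R0 u N) <= Series v - sum_f_R0 v N.
Proof.
intros Huv Hv.
assert (Hu : ex_series u).
{ apply (ex_series_le (V := R_CompleteNormedModule) u v); assumption. }
rewrite (Series_incr_n u (S N)), (Series_incr_n v (S N)) by (assumption || lia).
simpl pred.
replace (sum_f_R0 u N + Series (fun k => u (S N + k)%nat) - sum_f_R0 u N)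
  with (Series (fun k => u (S N + k)%nat)) by ring.
replace (sum_f_R0 v N + Series (fun k => v (S N + k)%nat) - sum_f_R0 v N)
  with (Series (fun k => v (S N + k)%nat)) by ring.
assert (Hv' : ex_series (fun k => v (S N + k)%nat))
  by (apply (ex_series_incr_n v); exact Hv).
assert (Hle : forall k, 0 <= Rabs (u (S N + k)%nat) <= v (S N + k)%nat).
{ intros k. split; [apply Rabs_pos|apply Huv]. }
apply Rle_trans with (Series (fun k => Rabs (u (S N + k)%nat))).
- apply Series_Rabs.
  apply (ex_series_le (V := R_CompleteNormedModule) _ (fun k => v (S N + k)%nat)).
  + intros k. change (Rabs (Rabs (u (S N + k)%nat)) <= v (S N + k)%nat).
    rewrite Rabs_Rabsolu. apply Huv.
  + exact Hv'.
- apply Series_le; assumption.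
Qed.

Lemma sin_n_neq_0 (k : nat) : sin_n k <> 0.
Proof.
unfold sin_n. apply Rmult_integral_contrapositive_currified.
- apply pow_nonzero. lra.
- apply Rinv_neq_0_compat, INR_fact_neq_0.
Qed.

Lemma sin_n_series_Rabs (w : R) : ex_series (fun k => Rabs (sin_n k * w ^ k)).
Proof.
apply (CV_disk_DAlembert sin_n w 0).
- exact sin_n_neq_0.
- apply is_lim_seq_Reals, Alembert_sin.
- left. reflexivity.
Qed.

(** Writing the sine as [y] times a power series in [y ^ 2] keeps every
    coefficient nonzero, as the ratio test requires. *)
Lemma sin_Series (y : R) : sin y = y * Series (fun k => sin_n k * (y ^ 2) ^ k).
Proof.
unfold sin. destruct (exist_sin (Rsqr y)) as [l Hl].
f_equal. symmetry. apply is_series_unique, is_series_Reals.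
replace (y ^ 2) with (Rsqr y) by (unfold Rsqr; ring). exact Hl.
Qed.

Lemma is_RInt_sum_f_R0 (f : nat -> R -> R) (I : nat -> R) (a b : R) (N : nat) :
  (forall k, is_RInt (f k) a b (I k)) ->
  is_RInt (fun t => sum_f_R0 (fun k => f k t) N) a b (sum_f_R0 I N).
Proof.
intros Hf. induction N as [|N IH].
- apply Hf.
- apply (is_RInt_plus (V := R_NormedModule)); [exact IH|apply Hf].
Qed.

(** As |cos phi| <= 1, the remainders of the series of sin (x cos phi) are
    bounded, uniformly in phi, by |x| times those of the absolutely convergent
    series at [x]; uniform convergence allows the exchange of sum and
    integral. *)
Lemma sin_cos_moment_series (nu x : R) :
  is_series (fun k => sin_n k * x ^ (2 * k + 1) * cos_moment nu (2 * k + 1))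
    (RInt (fun phi => sin (x * cos phi) * cos (nu * phi)) 0 (PI / 2)).
Proof.
pose (a := fun k => Rabs (sin_n k * (x ^ 2) ^ k)).
pose (f := fun N phi => sum_f_R0 (fun k =>
  sin_n k * x ^ (2 * k + 1) * (cos phi ^ (2 * k + 1) * cos (nu * phi))) N).
pose (g := fun phi => sin (x * cos phi) * cos (nu * phi)).
assert (Ha : ex_series a) by apply sin_n_series_Rabs.
assert (Hfg : forall N phi,
  Rabs (g phi - f N phi) <= Rabs x * (Series a - sum_f_R0 a N)).
{ intros N phi.
  pose (u := fun k => sin_n k * ((x * cos phi) ^ 2) ^ k).
  replace (g phi - f N phi)
    with (x * (Series u - sum_f_R0 u N) * (cos phi * cos (nu * phi))).
  2:{ symmetry. unfold g, f. rewrite sin_Series. fold u.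
      rewrite (sum_eq _ (fun k => u k * (x * cos phi * cos (nu * phi)))).
      - rewrite <- scal_sum. ring.
      - intros k _. unfold u. rewrite !pow_add, !pow_mult.
        rewrite (Rpow_mult_distr x), Rpow_mult_distr. ring. }
  assert (Hc : forall t, Rabs (cos t) <= 1).
  { intros t. apply Rabs_le, COS_bound. }
  assert (Hu : Rabs (Series u - sum_f_R0 u N) <= Series a - sum_f_R0 a N).
  { apply Series_remainder_le; [|exact Ha].
    intros k. unfold u, a. rewrite !Rabs_mult.
    apply Rmult_le_compat_l; [apply Rabs_pos|].
    rewrite <- !RPow_abs. apply pow_incr. split; [apply pow_le, Rabs_pos|].
    apply pow_incr. split; [apply Rabs_pos|]. rewrite Rabs_mult.
    rewrite <- (Rmult_1_r (Rabs x)) at 2.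
    apply Rmult_le_compat_l; [apply Rabs_pos|apply Hc]. }
  rewrite !Rabs_mult. rewrite <- (Rmult_1_r (Rabs x * (Series a - _))).
  apply Rmult_le_compat.
  - apply Rmult_le_pos; apply Rabs_pos.
  - apply Rmult_le_pos; apply Rabs_pos.
  - apply Rmult_le_compat_l; [apply Rabs_pos|exact Hu].
  - rewrite <- (Rmult_1_r 1).
    apply Rmult_le_compat; (apply Rabs_pos || apply Hc). }
assert (Htail : is_lim_seq
  (fun N => Rabs x * (Series a - sum_f_R0 a N)) 0).
{ replace (Finite 0) with (Rbar_mult (Rabs x) (Series a - Series a))
    by (simpl; f_equal; ring).
  apply is_lim_seq_scal_l. apply is_lim_seq_minus'.
  - apply is_lim_seq_const.
  - apply is_lim_seq_ext with (sum_n a).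
    + intros N. apply sum_n_Reals.
    + apply Series_correct, Ha. }
destruct (filterlim_RInt (V := R_CompleteNormedModule) f 0 (PI / 2) eventually
  eventually_filter g
  (sum_f_R0 (fun k => sin_n k * x ^ (2 * k + 1) * cos_moment nu (2 * k + 1))))
  as [I [HI Hg]].
- intros N. apply (is_RInt_sum_f_R0 (fun k phi =>
    sin_n k * x ^ (2 * k + 1) * (cos phi ^ (2 * k + 1) * cos (nu * phi)))).
  intros k. apply (is_RInt_scal (V := R_NormedModule)), cos_moment_correct.
- apply filterlim_locally. intros eps.
  apply is_lim_seq_spec in Htail. destruct (Htail eps) as [N0 HN0].
  exists N0. intros N HN phi.
  specialize (HN0 N HN). specialize (Hfg N phi).
  change (Rabs (f N phi - g phi) < eps).
  rewrite Rabs_minus_sym. apply Rle_lt_trans with (1 := Hfg).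
  apply Rle_lt_trans with (2 := HN0).
  rewrite Rminus_0_r. apply Rle_abs.
- fold g. rewrite (is_RInt_unique _ _ _ _ Hg).
  apply filterlim_ext with (2 := HI).
  intros N. symmetry. apply sum_n_Reals.
Qed.

(** The terms of the hypergeometric series and of the integrated sine series
    agree one by one. The condition on [nu] says that it is not an odd
    integer, which keeps all the denominators nonzero. *)
Lemma lommel_s_0_integral (nu x : R) :
  (forall i : nat, INR (2 * i + 1) ^ 2 <> nu ^ 2) ->
  cos (nu * (PI / 2)) * lommel_s 0 nu x =
  RInt (fun phi => sin (x * cos phi) * cos (nu * phi)) 0 (PI / 2).
Proof.
intros Hnu.
assert (H1 : 1 - nu ^ 2 <> 0).
{ generalize (Hnu 0%nat). simpl. lra. }
rewrite <- (is_series_unique _ _ (sin_cos_moment_series nu x)).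
unfold lommel_s, hyp1F2.
replace (powerRZ x (0 + 1)) with x by (simpl; ring).
replace ((0 + 1) ^ 2 - nu ^ 2) with (1 - nu ^ 2) by ring.
replace ((0 - nu + 3) / 2) with ((3 - nu) / 2) by field.
replace ((0 + nu + 3) / 2) with ((3 + nu) / 2) by field.
rewrite <- Rmult_assoc, <- Series_scal_l.
apply Series_ext. intros k.
destruct (cos_moment_odd nu k Hnu) as (-> & Hb & Hc).
rewrite pochhammer_1. unfold sin_n.
replace (- (x ^ 2 / 4)) with (-1 * x ^ 2 * / 4) by field.
rewrite !Rpow_mult_distr, pow_add, pow_mult, pow_1.
generalize (INR_fact_neq_0 k) (INR_fact_neq_0 (2 * k + 1)). intros.
field. repeat split; assumption.
Qed.

(** * The substitution t = cos phi *)

(** For 0 < s < 1 the substitution turns the integral over [0, s] into the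
    proper integral of the continuous function F (cos phi) over
    [acos s, pi/2]; this depends continuously on its lower end, which tends to
    0 as s tends to 1. *)
Lemma is_RInt_gen_cos_substitution (F : R -> R) :
  (forall t, continuous F t) ->
  is_RInt_gen (fun t => F t / sqrt (1 - t ^ 2)) (at_point 0) (at_left 1)
    (RInt (fun phi => F (cos phi)) 0 (PI / 2)).
Proof.
intros HF.
pose (f := fun t => F t / sqrt (1 - t ^ 2)).
pose (h := fun phi => F (cos phi)).
pose (G := fun a => RInt h a (PI / 2)).
assert (Hh : forall t, continuous h t).
{ intros t. apply (continuous_comp cos F); [apply continuous_cos|apply HF]. }
assert (Hf : forall t, -1 < t < 1 -> continuous f t).
{ intros t Ht.
  apply (continuous_mult F (fun u => / sqrt (1 - u ^ 2))); [apply HF|].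
  apply (ex_derive_continuous (V := R_NormedModule)).
  assert (0 < 1 - t ^ 2) by nra.
  auto_derive. split; [simpl in *; lra|]. split; [|trivial].
  apply Rgt_not_eq, sqrt_lt_R0. simpl in *; lra. }
assert (Hbound : forall s, 0 < s < 1 -> 0 < acos s < PI / 2).
{ intros s Hs. split; [apply acos_bound_lt; lra|].
  rewrite acos_atan by lra. apply atan_bound. }
assert (Hsub : forall s, 0 < s < 1 -> is_RInt f 0 s (G (acos s))).
{ intros s Hs. specialize (Hbound s Hs).
  assert (Hfs : ex_RInt f 0 s).
  { apply (ex_RInt_continuous (V := R_CompleteNormedModule)).
    rewrite Rmin_left, Rmax_right by lra.
    intros t Ht. apply Hf. lra. }
  replace (G (acos s)) with (RInt f 0 s).
  { apply (RInt_correct (V := R_CompleteNormedModule)), Hfs. }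
  generalize (RInt_comp (V := R_CompleteNormedModule) f cos
    (fun y => - sin y) (PI / 2) (acos s)).
  rewrite cos_PI2, cos_acos, Rmin_right, Rmax_left by lra.
  intros <-.
  - rewrite (RInt_ext _ (fun y => opp (h y))).
    + etransitivity;
        [apply (RInt_opp (V := R_CompleteNormedModule) h),
           ex_RInt_continuous_all, Hh|].
      apply opp_RInt_swap, ex_RInt_continuous_all, Hh.
    + rewrite Rmin_right, Rmax_left by lra. intros y Hy.
      change (- sin y * (F (cos y) / sqrt (1 - cos y ^ 2)) = - F (cos y)).
      assert (Hsin : 0 < sin y) by (apply sin_gt_0; lra).
      replace (1 - cos y ^ 2) with (sin y ^ 2)
        by (generalize (sin2_cos2 y); unfold Rsqr; lra).
      rewrite sqrt_pow2 by lra. field. lra.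
  - intros y Hy. apply Hf. split.
    + apply Rlt_le_trans with 0; [lra|]. apply cos_ge_0; lra.
    + rewrite <- cos_0. apply cos_decreasing_1; lra.
  - intros y _. split.
    + auto_derive; trivial. ring.
    + apply (ex_derive_continuous (V := R_NormedModule)).
      auto_derive; trivial. }
assert (Hlim : filterlim (fun s => G (acos s)) (at_left 1) (locally (G 0))).
(* The arctangent form of acos is visibly continuous at s = 1. *)
{ apply filterlim_ext_loc
    with (fun s => G (atan (sqrt (1 - Rsqr s) / s))).
  - exists (mkposreal 1 Rlt_0_1). intros s Hs Hs1.
    change (Rabs (s - 1) < 1) in Hs. apply Rabs_def2 in Hs.
    rewrite acos_atan by lra. reflexivity.
  - apply (filterlim_filter_le_1 (G := at_left 1) (F := locally 1));
      [apply filter_le_within|].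
    replace (G 0) with (G (atan (sqrt (1 - Rsqr 1) / 1))).
    2:{ rewrite Rsqr_1, Rminus_diag, sqrt_0, Rdiv_0_l, atan_0. reflexivity. }
    apply (continuous_comp (fun s => atan (sqrt (1 - Rsqr s) / s)) G).
    + apply continuous_atan_comp.
      apply (continuous_mult (fun s => sqrt (1 - Rsqr s)) Rinv).
      * apply continuous_sqrt_comp.
        apply (ex_derive_continuous (V := R_NormedModule)).
        unfold Rsqr. auto_derive; trivial.
      * apply (ex_derive_continuous (V := R_NormedModule)).
        auto_derive. lra.
    + apply (continuous_RInt_2 h _ (PI / 2)).
      apply filter_forall. intros a.
      apply (RInt_correct (V := R_CompleteNormedModule)).
      apply ex_RInt_continuous_all, Hh. }
intros P HP.
apply (Filter_prod _ _ _ (fun a => a = 0)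
  (fun s => 0 < s < 1 /\ P (G (acos s)))).
- reflexivity.
- apply filter_and.
  + exists (mkposreal 1 Rlt_0_1). intros s Hs Hs1.
    change (Rabs (s - 1) < 1) in Hs. apply Rabs_def2 in Hs. lra.
  + apply Hlim, HP.
- intros a s -> [Hs HPs]. exists (G (acos s)). split; [|exact HPs].
  apply Hsub, Hs.
Qed.

(** * The trigonometric kernel and the theorem *)

(** Telescoping of
    sin ((m+3) t) - sin ((m+1) t) = 2 sin t cos ((m+2) t). *)
Lemma sum_cos_even (n : nat) (t : R) :
  sin t <> 0 ->
  sum_f_R0 (fun k => cos (INR (2 * k) * t)) n =
  1 / 2 + 1 / 2 * chebyshevU (2 * n) (cos t).
Proof.
intros Ht. rewrite (chebyshevU_cos _ _ Ht).
induction n as [|n IH].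
- simpl. rewrite Rmult_0_l, cos_0, Rplus_0_l, Rmult_1_l. field. exact Ht.
- cbn [sum_f_R0]. rewrite IH.
  replace (INR (2 * S n)) with (INR (2 * n) + 2)
    by (rewrite !mult_INR, (S_INR n); simpl; ring).
  set (m := INR (2 * n)).
  replace ((m + 2 + 1) * t) with ((m + 2) * t + t) by ring.
  replace ((m + 1) * t) with ((m + 2) * t - t) by ring.
  rewrite sin_plus, sin_minus. field. exact Ht.
Qed.

Theorem mainTheorem3 (n : nat) (x : R) :
  ex_RInt_gen
    (fun t : R => sin (x * t) * (chebyshevU (2 * n) t / sqrt (1 - t ^ 2)))
    (at_point 0) (at_left 1) /\
  sum_f_R0 (fun k : nat => (-1) ^ k * lommel_s 0 (INR (2 * k)) x) n =
  PI / 4 * struveH0 x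
  + 1 / 2 *
    RInt_gen
      (fun t : R => sin (x * t) * (chebyshevU (2 * n) t / sqrt (1 - t ^ 2)))
      (at_point 0) (at_left 1).
Proof.
pose (F := fun t => sin (x * t) * chebyshevU (2 * n) t).
assert (HF : forall t, continuous F t).
{ intros t. apply (continuous_mult (fun u => sin (x * u)) (chebyshevU (2 * n))).
  - apply (ex_derive_continuous (V := R_NormedModule)). auto_derive; trivial.
  - apply chebyshevU_continuous. }
assert (Hsin : forall t, continuous (fun phi => sin (x * cos phi)) t).
{ intros t. apply (ex_derive_continuous (V := R_NormedModule)).
  auto_derive; trivial. }
assert (HU : is_RInt_gen
  (fun t : R => sin (x * t) * (chebyshevU (2 * n) t / sqrt (1 - t ^ 2)))
  (at_point 0) (at_left 1) (RInt (fun phi => F (cos phi)) 0 (PI / 2))).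
{ apply is_RInt_gen_ext with (fun t => F t / sqrt (1 - t ^ 2)).
  - apply filter_forall. intros ab t _. apply Rmult_assoc.
  - apply is_RInt_gen_cos_substitution, HF. }
split; [eexists; exact HU|].
rewrite (is_RInt_gen_unique _ _ HU).
rewrite (sum_eq _ (fun k => RInt (fun phi =>
  sin (x * cos phi) * cos (INR (2 * k) * phi)) 0 (PI / 2))).
2:{ intros k _. rewrite <- lommel_s_0_integral.
    - rewrite mult_INR. simpl (INR 2).
      replace ((1 + 1) * INR k * (PI / 2)) with (INR k * PI) by field.
      rewrite cos_INR_PI. reflexivity.
    - (* Squares of odd and of even integers differ in parity. *)
      intros i E. rewrite <- !pow_INR in E. apply INR_eq in E. simpl in E. lia. }
unfold struveH0.
replace (PI / 4 * (2 / PI * RInt (fun phi => sin (x * cos phi)) 0 (PI / 2)))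
  with (1 / 2 * RInt (fun phi => sin (x * cos phi)) 0 (PI / 2))
  by (field; apply PI_neq0).
assert (Hpt : forall phi, 0 < phi < PI / 2 ->
  sum_f_R0 (fun k => sin (x * cos phi) * cos (INR (2 * k) * phi)) n =
  1 / 2 * sin (x * cos phi) + 1 / 2 * F (cos phi)).
{ intros phi Hphi.
  rewrite (sum_eq _ (fun k => cos (INR (2 * k) * phi) * sin (x * cos phi)))
    by (intros; ring).
  rewrite <- scal_sum, sum_cos_even.
  - unfold F. ring.
  - apply Rgt_not_eq, sin_gt_0; lra. }
assert (Hsum : is_RInt
  (fun phi => 1 / 2 * sin (x * cos phi) + 1 / 2 * F (cos phi)) 0 (PI / 2)
  (sum_f_R0 (fun k => RInt (fun phi =>
    sin (x * cos phi) * cos (INR (2 * k) * phi)) 0 (PI / 2)) n)).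
{ apply is_RInt_ext with (fun phi => sum_f_R0 (fun k =>
    sin (x * cos phi) * cos (INR (2 * k) * phi)) n).
  - generalize PI_RGT_0. intros Hpi. rewrite Rmin_left, Rmax_right by lra.
    exact Hpt.
  - apply (is_RInt_sum_f_R0 (fun k phi =>
      sin (x * cos phi) * cos (INR (2 * k) * phi))).
    intros k. apply (RInt_correct (V := R_CompleteNormedModule)).
    apply ex_RInt_continuous_all. intros t.
    apply (ex_derive_continuous (V := R_NormedModule)). auto_derive; trivial. }
rewrite <- (is_RInt_unique _ _ _ _ Hsum).
apply is_RInt_unique.
apply (is_RInt_plus (V := R_NormedModule));
  apply (is_RInt_scal (V := R_NormedModule));
  apply (RInt_correct (V := R_CompleteNormedModule)), ex_RInt_continuous_all.
- exact Hsin.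
- intros t. apply (continuous_comp cos F); [apply continuous_cos|apply HF].
Qed.
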